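(* Let $(M,\varphi,g)$ be an almost Golden Riemannian manifold, let $\nabla^{0}$ be its first canonical connection and let $\mathrm{T}^{0}$ be the torsion tensor of $\nabla^{0}$. The structure $\varphi$ is integrable if and only if $$\mathrm{T}^{0}(X,Y)=0 \ \text{ for all } X,Y\in D_{\phi}\quad\text{and}\quad \mathrm{T}^{0}(X,Y)=0\ \text{ for all } X,Y\in D_{\bar\phi}.$$
   Context: Manifolds and tensor fields are of class $C^\infty$; $\mathfrak{X}(M)$ denotes the module of vector fields on $M$. An almost Golden structure on $M$ is a tensor field $\varphi$ of type $(1,1)$ with $\varphi^2=\varphi+Id$ (a polynomial structure of degree exactly 2, i.e. $\varphi$ and $Id$ are linearly independent). An almost Golden Riemannian manifold $(M,\varphi,g)$ is a manifold with an almost Golden structure $\varphi$ and a Riemannian metric $g$ such that $g(\varphi X,Y)=g(X,\varphi Y)$ for all $X,Y\in\mathfrak{X}(M)$. The induced almost product structure is $J_\varphi=\frac{1}{\sqrt5}(2\varphi-Id)$, which satisfies $J_\varphi^2=Id$. Let $\phi=\frac{1+\sqrt5}{2}$, $\bar\phi=\frac{1-\sqrt5}{2}$; $D_\phi=\ker(\varphi-\phi\, Id)$ and $D_{\bar\phi}=\ker(\varphi-\bar\phi\, Id)$ are the eigendistributions of $\varphi$ (so $TM=D_\phi\oplus D_{\bar\phi}$), and $X\in D_\phi$ means that $X$ is a vector field on $M$ taking values in $D_\phi$ (similarly for $D_{\bar\phi}$). The structure $\varphi$ is integrable if its Nijenhuis tensor $N_\varphi(X,Y)=\varphi^2[X,Y]+[\varphi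 X,\varphi Y]-\varphi[\varphi X,Y]-\varphi[X,\varphi Y]$ vanishes. The first canonical connection of $(M,\varphi,g)$ is the linear connection with covariant derivative $\nabla^{0}_XY=\nabla^{\mathrm g}_XY-\frac12(\nabla^{\mathrm g}_XJ_\varphi)J_\varphi Y$, where $\nabla^{\mathrm g}$ is the Levi-Civita connection of $g$. *)

(* Defs.v *)
From HB Require Import structures.
From mathcomp Require Import all_boot all_order all_algebra.
From mathcomp Require Import mathcomp_extra boolp classical_sets functions.
From mathcomp Require Import ring reals topology normedtype derive.

Set Implicit Arguments.
Unset Strict Implicit.
Unset Printing Implicit Defensive.

Import Order.TTheory GRing.Theory Num.Theory.
Import numFieldNormedType.Exports.

Local Open Scope classical_set_scope.
Local Open Scope ring_scope.

Section EuclideanSmoothness.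
Context {R : realType} {n : nat}.
Implicit Types (U : set 'rV[R]_n) (f g : 'rV[R]_n -> R).

Definition partial (i : 'I_n) f : 'rV[R]_n -> R :=
  fun x => 'D_(delta_mx 0 i) f x.

Fixpoint Ck (k : nat) U f : Prop :=
  (forall x, U x -> {for x, continuous f}) /\
  (if k is k'.+1 then
     forall i, (forall x, U x -> derivable f x (delta_mx 0 i)) /\
               Ck k' U (partial i f)
   else True).

Definition smooth_on U f := forall k, Ck k U f.

Lemma Ck_cont k U f : Ck k U f -> forall x, U x -> {for x, continuous f}.
Proof. by case: k => [|k] []. Qed.

Lemma CkW k U f : Ck k.+1 U f -> Ck k U f.
Proof.
elim: k f => [|k IHk] f [fc fd]; first by split.
by split=> // i; have [fi1 fi2] := fd i; split=> //; apply: IHk.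
Qed.

Lemma near_open U f g : open U -> {in U, f =1 g} ->
  forall x, U x -> \forall y \near x, f y = g y.
Proof.
move=> oU fg x Ux; have : \forall y \near x, U y by exact: open_nbhs_nbhs.
by apply: filterS => y Uy; apply: fg; rewrite inE.
Qed.

Lemma Ck_ext k U f g : open U -> {in U, f =1 g} -> Ck k U f -> Ck k U g.
Proof.
move=> oU; elim: k f g => [|k IHk] f g fg [fc fd]; split=> //.
- move=> x Ux; rewrite /prop_for /continuous_at -(fg x) ?inE//.
  exact: cvg_trans (near_eq_cvg (near_open oU fg Ux)) (fc x Ux).
- move=> x Ux; rewrite /prop_for /continuous_at -(fg x) ?inE//.
  exact: cvg_trans (near_eq_cvg (near_open oU fg Ux)) (fc x Ux).
- move=> i; have [di ci] := fd i; split.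
    move=> x Ux; apply: near_eq_derivable (di x Ux); exact: (near_open oU fg Ux).
  apply: IHk ci => x; rewrite inE => Ux.
  by apply: near_eq_derive; exact: (near_open oU fg Ux).
Qed.

Lemma Ck_cst k U (c : R) : Ck k U (cst c).
Proof.
elim: k c => [|k IHk] c.
  by split; [move=> x _; exact: cst_continuous|].
split; first by move=> x _; exact: cst_continuous.
move=> i; split; first by move=> x _; exact: derivable_cst.
have -> : partial i (cst c) = cst 0; last exact: IHk.
by apply/funext => x; rewrite /partial derive_cst.
Qed.

Lemma CkN k U f : open U -> Ck k U f -> Ck k U (- f).
Proof.
move=> oU; elim: k f => [|k IHk] f [fc fd].
  by split; [move=> x Ux; apply: continuousN; exact: fc|].
split; first by move=> x Ux; apply: continuousN; exact: fc.
move=> i; have [di ci] := fd i; split.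
  by move=> x Ux; apply: derivableN; exact: di.
apply: (Ck_ext oU _ (IHk _ ci)) => x; rewrite inE => Ux.
by rewrite /partial (deriveN (di x Ux)).
Qed.

Lemma CkD k U f g : open U -> Ck k U f -> Ck k U g -> Ck k U (f + g).
Proof.
move=> oU; elim: k f g => [|k IHk] f g [fc fd] [gc gd].
  by split; [move=> x Ux; apply: continuousD; [exact: fc|exact: gc]|].
split; first by move=> x Ux; apply: continuousD; [exact: fc|exact: gc].
move=> i; have [di ci] := fd i; have [di' ci'] := gd i; split.
  by move=> x Ux; apply: derivableD; [exact: di|exact: di'].
apply: (Ck_ext oU _ (IHk _ _ ci ci')) => x; rewrite inE => Ux.
by rewrite /partial (deriveD (di x Ux) (di' x Ux)).
Qed.

Lemma CkM k U f g : open U -> Ck k U f -> Ck k U g -> Ck k U (f * g).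
Proof.
move=> oU; elim: k f g => [|k IHk] f g Cf Cg.
  split; last by [].
  by move=> x Ux; apply: continuousM; [exact: (Ck_cont Cf)|exact: (Ck_cont Cg)].
split=> [x Ux|i]; first by apply: continuousM;
  [exact: (Ck_cont Cf)|exact: (Ck_cont Cg)].
have [di ci] := Cf.2 i; have [di' ci'] := Cg.2 i; split.
  by move=> x Ux; apply: derivableM; [exact: di|exact: di'].
have := CkD oU (IHk _ _ (CkW Cf) ci') (IHk _ _ (CkW Cg) ci).
apply: Ck_ext => // x; rewrite inE => Ux.
by rewrite /partial (deriveM (di x Ux) (di' x Ux)).
Qed.

End EuclideanSmoothness.

Record chart (R : realType) (M : topologicalType) (n : nat) := Chart {
  chart_dom : set M;
  chart_to :> M -> 'rV[R]_n;
  chart_inv : 'rV[R]_n -> M;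
  chart_dom_open : open chart_dom;
  chart_img_open : open (chart_to @` chart_dom);
  chart_toK : {in chart_dom, cancel chart_to chart_inv};
  chart_to_cont : forall p, chart_dom p -> {for p, continuous chart_to};
  chart_inv_cont : forall x, (chart_to @` chart_dom) x ->
    {for x, continuous chart_inv}
}.

(* An atlas need not be maximal: it determines a unique maximal one, and the
   same smooth functions. *)
Record smoothManifold (R : realType) (n : nat) := SmoothManifold {
  mfld_carrier :> topologicalType;
  mfld_hausdorff : hausdorff_space mfld_carrier;
  mfld_second_countable : @second_countable mfld_carrier;
  atlas : set (chart R mfld_carrier n);
  atlas_cover : forall p, exists2 c, atlas c & chart_dom c p;
  atlas_compatible : forall c1 c2, atlas c1 -> atlas c2 -> forall i : 'I_n,
    smooth_on (c1 @` (chart_dom c1 `&` chart_dom c2))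
              (fun x => c2 (chart_inv c1 x) 0 i)
}.

Section SmoothFunctions.
Context {R : realType} {n : nat} (M : smoothManifold R n).

Definition smooth (f : M -> R) : Prop := forall c, atlas c ->
  smooth_on (c @` chart_dom c) (f \o chart_inv c).

Definition smooth_pred : {pred M -> R} := fun f => `[< smooth f >].

Record Cinf := MkCinf { sfun :> M -> R; _ : sfun \in smooth_pred }.

HB.instance Definition _ := [isSub for sfun].
HB.instance Definition _ := [Choice of Cinf by <:].

Lemma smooth_cst (c : R) : smooth (cst c).
Proof. by move=> ch _ k; exact: Ck_cst. Qed.

Lemma smooth_subring_closed : subring_closed smooth_pred.
Proof.
split=> [|f g|f g]; rewrite ?unfold_in.
- by apply/asboolP; exact: smooth_cst.
- move=> /asboolP fS /asboolP gS; apply/asboolP => c ac k.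
  have -> : (f - g) \o chart_inv c =
    (f \o chart_inv c) - (g \o chart_inv c) by [].
  apply: CkD (fS c ac k) (CkN _ (gS c ac k)); exact: chart_img_open.
- move=> /asboolP fS /asboolP gS; apply/asboolP => c ac k.
  have -> : (f * g) \o chart_inv c =
    (f \o chart_inv c) * (g \o chart_inv c) by [].
  apply: CkM (fS c ac k) (gS c ac k); exact: chart_img_open.
Qed.

HB.instance Definition _ :=
  GRing.isSubringClosed.Build (M -> R) smooth_pred smooth_subring_closed.
HB.instance Definition _ := 
  GRing.SubChoice_isSubComPzRing.Build (M -> R) smooth_pred Cinf
    smooth_subring_closed.

Lemma sfunP (f : Cinf) : smooth f.
Proof. by case: f => f /= /asboolP. Qed.

Definition to_Cinf (f : M -> R) (fS : smooth f) : Cinf := MkCinf (asboolT fS).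

Definition cst_Cinf (c : R) : Cinf := to_Cinf (smooth_cst c).

Lemma Cinf_ext (f g : Cinf) : (forall p, f p = g p) -> f = g.
Proof. by move=> fg; apply/val_inj/funext. Qed.

End SmoothFunctions.

Section Tangent.
Context {R : realType} {n : nat} (M : smoothManifold R n).

(* R-linear derivations of the ring of smooth functions at p. *)
Definition point_derivation (p : M) (v : Cinf M -> R^o) : Prop :=
  (forall (c : R) (f g : Cinf M), v (cst_Cinf M c * f + g) = c * v f + v g) /\
  (forall f g : Cinf M, v (f * g) = f p * v g + g p * v f).

Definition point_derivation_pred (p : M) : {pred Cinf M -> R^o} :=
  fun v => `[< point_derivation p v >].

Record tangent (p : M) := MkTangent {
  tvec :> Cinf M -> R^o; _ : tvec \in point_derivation_pred p }.

Section TangentLmod.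
Context (p : M).

HB.instance Definition _ := [isSub for @tvec p].
HB.instance Definition _ := [Choice of tangent p by <:].

Lemma point_derivation_submod : subsemimod_closed (point_derivation_pred p).
Proof.
split; first split.
- apply/asboolP; split=> [c f g|f g]; first by rewrite [LHS]/= mulr0 addr0.
  by rewrite [LHS]/= !mulr0 addr0.
- move=> u v /asboolP[uL uD] /asboolP[vL vD]; apply/asboolP; split.
    move=> c f g; rewrite ![(u + v) _]/= /GRing.add /= uL vL.
    by rewrite mulrDr addrACA.
  move=> f g; rewrite ![(u + v) _]/= /GRing.add /= uD vD.
  by rewrite !mulrDr addrACA.
- move=> a v /asboolP[vL vD]; apply/asboolP; split=> [c f g|f g].
    rewrite -![(a *: v) _]/(a * v _) vL.
    by rewrite mulrDr mulrCA.
  rewrite -![(a *: v) _]/(a * v _) vD.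
  by rewrite mulrDr mulrCA (mulrCA a (g p)).
Qed.

HB.instance Definition _ :=
  GRing.isSubmodClosed.Build R (Cinf M -> R^o) (point_derivation_pred p)
    point_derivation_submod.
HB.instance Definition _ :=
  GRing.SubChoice_isSubLmodule.Build R (Cinf M -> R^o)
    (point_derivation_pred p) (tangent p) point_derivation_submod.

Lemma tangentP (v : tangent p) : point_derivation p v.
Proof. by case: v => v /= /asboolP. Qed.

Lemma tangent_ext (u v : tangent p) : (forall f, u f = v f) -> u = v.
Proof. by move=> uv; apply/val_inj/funext. Qed.

Lemma tangentDE (u v : tangent p) f : (u + v) f = u f + v f.
Proof. by []. Qed.

Lemma tangentNE (u : tangent p) f : (- u) f = - u f.
Proof. by []. Qed.

Lemma tangentZE (a : R) (u : tangent p) f : (a *: u) f = a * u f.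
Proof. by []. Qed.

Lemma tangent0E f : (0 : tangent p) f = 0.
Proof. by []. Qed.

End TangentLmod.

(* A field of tangent vectors is smooth when it maps smooth functions to smooth
   functions. *)
Record vfield := MkVfield {
  vf_at :> forall p, tangent p;
  vf_smooth : forall f : Cinf M, smooth (fun p => vf_at p f)
}.

Definition vapp (X : vfield) (f : Cinf M) : Cinf M := to_Cinf (vf_smooth X f).

Lemma vfield_ext (X Y : vfield) : (forall p, X p = Y p) -> X = Y.
Proof.
case: X Y => [X Xs] [Y Ys] /= XY.
have E : X = Y by apply: functional_extensionality_dep.
by rewrite E in Xs *; congr MkVfield; exact: Prop_irrelevance.
Qed.

Lemma vzero_smooth f : smooth (fun p => (0 : tangent p) f).
Proof. exact: sfunP (0 : Cinf M). Qed.

Lemma vadd_smooth (X Y : vfield) f : smooth (fun p => (X p + Y p) f).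
Proof. exact: sfunP (vapp X f + vapp Y f). Qed.

Lemma vopp_smooth (X : vfield) f : smooth (fun p => (- X p) f).
Proof. exact: sfunP (- vapp X f). Qed.

Lemma vscale_smooth (h : Cinf M) (X : vfield) f :
  smooth (fun p => (h p *: X p) f).
Proof. exact: sfunP (h * vapp X f). Qed.

HB.instance Definition _ := gen_eqMixin vfield.
HB.instance Definition _ := gen_choiceMixin vfield.

Definition vzero := MkVfield vzero_smooth.
Definition vopp X := MkVfield (vopp_smooth X).
Definition vadd X Y := MkVfield (vadd_smooth X Y).
Definition vscale h X := MkVfield (vscale_smooth h X).

Lemma vaddA : associative vadd.
Proof. by move=> X Y Z; apply: vfield_ext => p; exact: addrA. Qed.

Lemma vaddC : commutative vadd.
Proof. by move=> X Y; apply: vfield_ext => p; exact: addrC. Qed.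

Lemma vadd0 : left_id vzero vadd.
Proof. by move=> X; apply: vfield_ext => p; exact: add0r. Qed.

Lemma vaddN : left_inverse vzero vopp vadd.
Proof. by move=> X; apply: vfield_ext => p; exact: addNr. Qed.

HB.instance Definition _ :=
  GRing.isZmodule.Build vfield vaddA vaddC vadd0 vaddN.

Lemma vscaleA (h k : Cinf M) X : vscale h (vscale k X) = vscale (h * k) X.
Proof. by apply: vfield_ext => p; exact: scalerA. Qed.

Lemma vscale1 : left_id 1 vscale.
Proof. by move=> X; apply: vfield_ext => p; exact: scale1r. Qed.

Lemma vscaleDr : right_distributive vscale +%R.
Proof. by move=> h X Y; apply: vfield_ext => p; exact: scalerDr. Qed.

Lemma vscaleDl X : {morph vscale^~ X : h k / h + k}.
Proof. by move=> h k; apply: vfield_ext => p; exact: scalerDl. Qed.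

HB.instance Definition _ := GRing.Zmodule_isLmodule.Build (Cinf M) vfield
  vscaleA vscale1 vscaleDr vscaleDl.

Lemma vfieldDE (X Y : vfield) p : (X + Y) p = X p + Y p.
Proof. by []. Qed.

Lemma vfieldNE (X : vfield) p : (- X) p = - X p.
Proof. by []. Qed.

Lemma vfieldZE (h : Cinf M) (X : vfield) p : (h *: X) p = h p *: X p.
Proof. by []. Qed.

Definition bracket_at (X Y : vfield) (p : M) : Cinf M -> R^o :=
  fun f => X p (vapp Y f) - Y p (vapp X f).

Lemma bracket_at_derivation X Y p : bracket_at X Y p \in point_derivation_pred p.
Proof.
have vlin (Z : vfield) (c : R) f g :
    vapp Z (cst_Cinf M c * f + g) = cst_Cinf M c * vapp Z f + vapp Z g.
  by apply: Cinf_ext => q; exact: (tangentP (Z q)).1.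
have vmul (Z : vfield) f g : vapp Z (f * g) = f * vapp Z g + g * vapp Z f.
  by apply: Cinf_ext => q; exact: (tangentP (Z q)).2.
have tadd (v : tangent p) f g : v (f + g) = v f + v g.
  have := (tangentP v).1 1 f g.
  have -> : cst_Cinf M 1 = 1 by apply: Cinf_ext.
  by rewrite !mul1r.
apply/asboolP; split=> [c f g|f g]; rewrite /bracket_at.
  rewrite !vlin (tangentP (X p)).1 (tangentP (Y p)).1.
  by rewrite mulrBr opprD addrACA.
rewrite !vmul !tadd !(tangentP (X p)).2 !(tangentP (Y p)).2.
have alg (x y a b c d u v w z : R) :
    (x * u + d * a + (y * v + b * c)) - (x * w + c * b + (y * z + a * d)) =
    x * (u - w) + y * (v - z) by ring.
exact: alg.
Qed.

Definition bracket (X Y : vfield) : vfield.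
Proof.
refine (@MkVfield (fun p => MkTangent (bracket_at_derivation X Y p)) _) => f.
exact: sfunP (vapp X (vapp Y f) - vapp Y (vapp X f)).
Defined.

End Tangent.

Section Geometry.
Context {R : realType} {n : nat} {M : smoothManifold R n}.

(* A field of endomorphisms of the tangent spaces is smooth when it maps smooth
   vector fields to smooth vector fields; metrics are treated likewise. *)
Record tensor11 := MkTensor11 {
  tf_at :> forall p : M, {linear tangent p -> tangent p};
  tf_smooth : forall (X : vfield M) (f : Cinf M),
    smooth (fun p => tf_at p (X p) f)
}.

Definition tapp (t : tensor11) (X : vfield M) : vfield M :=
  MkVfield (tf_smooth t X).

Lemma tapp_linear (t : tensor11) : linear (tapp t).
Proof. by move=> f X Y; apply: vfield_ext => p; exact: linearP. Qed.

HB.instance Definition _ t := GRing.isLinear.Build (Cinf M) (vfield M)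
  (vfield M) *:%R (tapp t) (tapp_linear t).

Record riemannian_metric := MkRiemannianMetric {
  rm_at :> forall p : M, tangent p -> tangent p -> R;
  rm_linear : forall p (a : R) (u v w : tangent p),
    rm_at (a *: u + v) w = a * rm_at u w + rm_at v w;
  rm_sym : forall p (u v : tangent p), rm_at u v = rm_at v u;
  rm_pos : forall p (v : tangent p), v != 0 -> 0 < rm_at v v;
  rm_smooth : forall X Y : vfield M, smooth (fun p => rm_at (X p) (Y p))
}.

Definition inner (g : riemannian_metric) (X Y : vfield M) : Cinf M :=
  to_Cinf (rm_smooth g X Y).

Record connection := MkConnection {
  cov :> vfield M -> vfield M -> vfield M;
  cov_linear : forall (f : Cinf M) (X Y Z : vfield M),
    cov (f *: X + Y) Z = f *: cov X Z + cov Y Z;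
  covD : forall X Y Z : vfield M, cov X (Y + Z) = cov X Y + cov X Z;
  cov_leibniz : forall (f : Cinf M) (X Y : vfield M),
    cov X (f *: Y) = vapp X f *: Y + f *: cov X Y
}.

Definition torsion (nabla : connection) (X Y : vfield M) : vfield M :=
  nabla X Y - nabla Y X - bracket X Y.

Definition cov_tensor (nabla : connection) (t : tensor11) (X Y : vfield M) :
  vfield M := nabla X (tapp t Y) - tapp t (nabla X Y).

Definition levi_civita (g : riemannian_metric) (nabla : connection) : Prop :=
  (forall X Y, torsion nabla X Y = 0) /\
  (forall X Y Z, vapp X (inner g Y Z) =
     inner g (nabla X Y) Z + inner g Y (nabla X Z)).

Definition nijenhuis (t : tensor11) (X Y : vfield M) : vfield M :=
  tapp t (tapp t (bracket X Y)) + bracket (tapp t X) (tapp t Y)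
  - tapp t (bracket (tapp t X) Y) - tapp t (bracket X (tapp t Y)).

Definition integrable_structure (t : tensor11) : Prop :=
  forall X Y, nijenhuis t X Y = 0.

(* Independence of [phi] and the identity is over the reals and global on [M],
   hence a weaker hypothesis than independence at every point of [M]. *)
Definition almost_golden (phi : tensor11) : Prop :=
  (forall p (v : tangent p), phi p (phi p v) = phi p v + v) /\
  (forall a b : R, (forall p (v : tangent p), a *: phi p v + b *: v = 0) ->
     a = 0 /\ b = 0).

Definition almost_golden_riemannian (phi : tensor11) (g : riemannian_metric) :
  Prop := almost_golden phi /\
  (forall X Y, inner g (tapp phi X) Y = inner g X (tapp phi Y)).

Definition golden_ratio : R := (1 + Num.sqrt 5) / 2.
Definition golden_ratio_conj : R := (1 - Num.sqrt 5) / 2.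

Definition eigendistribution (phi : tensor11) (c : R) (p : M) :
  set (tangent p) := [set v | phi p v - c *: v = 0].

Definition in_distribution (D : forall p : M, set (tangent p))
  (X : vfield M) : Prop := forall p, D p (X p).

Section AlmostProduct.
Context (phi : tensor11).

Definition almost_product_at (p : M) (v : tangent p) : tangent p :=
  (Num.sqrt 5)^-1 *: (2 *: phi p v - v).

Lemma almost_product_linear p : linear (@almost_product_at p).
Proof.
move=> a u v; rewrite /almost_product_at (linearP (phi p)).
have -> : 2 *: (a *: phi p u + phi p v) - (a *: u + v) =
    a *: (2 *: phi p u - u) + (2 *: phi p v - v).
  by rewrite scalerDr scalerBr !scalerA opprD addrACA mulrC.
by rewrite scalerDr !scalerA mulrC.
Qed.

HB.instance Definition _ p := GRing.isLinear.Build R (tangent p) (tangent p)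
  *:%R (@almost_product_at p) (@almost_product_linear p).

Lemma almost_product_smooth (X : vfield M) f :
  smooth (fun p => almost_product_at (X p) f).
Proof.
exact: sfunP (cst_Cinf M (Num.sqrt 5)^-1 *
  (cst_Cinf M 2 * vapp (tapp phi X) f - vapp X f)).
Qed.

Definition almost_product : tensor11 :=
  @MkTensor11 (fun p => @almost_product_at p : {linear _ -> _})
    almost_product_smooth.

End AlmostProduct.

Section FirstCanonicalConnection.
Context (nabla : connection) (phi : tensor11).
Let J := almost_product phi.

Definition first_canonical_cov (X Y : vfield M) : vfield M :=
  nabla X Y - cst_Cinf M (2^-1) *: cov_tensor nabla J X (tapp J Y).

Lemma cov_tensor_linearl t f X Y Z : cov_tensor nabla t (f *: X + Y) Z =
  f *: cov_tensor nabla t X Z + cov_tensor nabla t Y Z.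
Proof.
by rewrite /cov_tensor !cov_linear (linearP (tapp t)) scalerBr opprD addrACA.
Qed.

Lemma cov_tensorD t X Y Z : cov_tensor nabla t X (Y + Z) =
  cov_tensor nabla t X Y + cov_tensor nabla t X Z.
Proof.
by rewrite /cov_tensor (linearD (tapp t)) !covD (linearD (tapp t)) opprD addrACA.
Qed.

Lemma cov_tensorZ t f X Y : cov_tensor nabla t X (f *: Y) =
  f *: cov_tensor nabla t X Y.
Proof.
rewrite /cov_tensor (linearZZ (tapp t)) !cov_leibniz.
rewrite (linearD (tapp t)) !(linearZZ (tapp t)).
by rewrite opprD addrACA subrr add0r scalerBr.
Qed.

Lemma first_canonical_linear f X Y Z : first_canonical_cov (f *: X + Y) Z =
  f *: first_canonical_cov X Z + first_canonical_cov Y Z.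
Proof.
rewrite /first_canonical_cov cov_linear cov_tensor_linearl.
rewrite (scalerDr (cst_Cinf M _)) (scalerBr f (nabla X Z)) !scalerA (mulrC f).
by rewrite opprD addrACA.
Qed.

Lemma first_canonicalD X Y Z : first_canonical_cov X (Y + Z) =
  first_canonical_cov X Y + first_canonical_cov X Z.
Proof.
by rewrite /first_canonical_cov covD (linearD (tapp J)) cov_tensorD scalerDr opprD addrACA.
Qed.

Lemma first_canonical_leibniz f X Y : first_canonical_cov X (f *: Y) =
  vapp X f *: Y + f *: first_canonical_cov X Y.
Proof.
rewrite /first_canonical_cov cov_leibniz (linearZZ (tapp J)) cov_tensorZ.
by rewrite (scalerBr f (nabla X Y)) !scalerA addrA (mulrC f).
Qed.

Definition first_canonical_connection : connection :=
  MkConnection first_canonical_linear first_canonicalD first_canonical_leibniz.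

End FirstCanonicalConnection.

End Geometry.

Arguments tensor11 {R n} M.
Arguments riemannian_metric {R n} M.
Arguments connection {R n} M.

(* Main.v *)
Require Import Defs.
From mathcomp Require Import all_boot all_order all_algebra.
From mathcomp Require Import reals.
From mathcomp Require Import ring topology.

(** The theorem compares two obstructions to the involutivity of the
    eigendistributions of [phi].  Write [c] for a root of [c^2 = c + 1] and [J]
    for the almost product structure.

    If [X] and [Y] are eigenfields of [phi] for [c] and [d], then the Nijenhuis
    tensor collapses to [(phi - c)(phi - d)] applied to the bracket [[X, Y]]
    ([nijenhuis_eigen]).  When [c] and [d] are the two distinct roots, this is
    zero because [(phi - c)(phi - d)] is the polynomial annihilating [phi]
    ([nijenhuis_mixed]).  So only pairs of fields in the same eigendistribution
    matter, since every field is the sum of its two eigencomponents, which are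
    again smooth ([golden_decomposition]), and the Nijenhuis tensor is biadditive.

    For such a pair, [J] acts on [X] and [Y] as a common sign [s], and the
    covariant derivative [(nabla_X Y + J (nabla_X (J Y))) / 2] becomes
    [(1 + s J) / 2] applied to [nabla_X Y].  As the Levi-Civita connection is
    torsion free, the torsion of the canonical connection is [(s J - 1) / 2]
    applied to [[X, Y]], again the part of the bracket that leaves the
    distribution.  Comparing constants, the Nijenhuis tensor is exactly [- 5]
    times that torsion ([nijenhuis_torsion]). *)

Set Implicit Arguments.
Unset Strict Implicit.
Unset Printing Implicit Defensive.

Import Order.TTheory GRing.Theory Num.Theory.
Local Open Scope ring_scope.

(** * The two roots of the golden polynomial *)

Section GoldenRatio.
Context (R : realType).
Local Notation a := (golden_ratio : R).
Local Notation b := (golden_ratio_conj : R).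

Lemma sqrt5M : Num.sqrt 5 * Num.sqrt 5 = 5 :> R.
Proof. by rewrite -expr2 sqr_sqrtr. Qed.

Lemma sqrt5_neq0 : Num.sqrt 5 != 0 :> R.
Proof. by rewrite sqrtr_eq0 -ltNge ltr0n. Qed.

Lemma golden_ratioD : a + b = 1.
Proof. by rewrite /golden_ratio /golden_ratio_conj; field. Qed.

Lemma golden_ratioM : a * b = -1.
Proof.
have s5 := sqrt5M.
by rewrite /golden_ratio /golden_ratio_conj; field: s5.
Qed.

Lemma golden_ratio_neq : a != b.
Proof.
rewrite -subr_eq0; have -> : a - b = Num.sqrt 5.
  by rewrite /golden_ratio /golden_ratio_conj; field.
exact: sqrt5_neq0.
Qed.

Lemma sqr_golden_ratio : a ^+ 2 = a + 1.
Proof.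
have -> : a ^+ 2 = a * (a + b) - a * b by ring.
by rewrite golden_ratioD golden_ratioM mulr1 opprK.
Qed.

Lemma sqr_golden_ratio_conj : b ^+ 2 = b + 1.
Proof.
have -> : b ^+ 2 = b * (a + b) - a * b by ring.
by rewrite golden_ratioD golden_ratioM mulr1 opprK.
Qed.

End GoldenRatio.

(** * Brackets and connections under constant scalars *)

Section Evaluation.
Context {R : realType} {n : nat} {M : smoothManifold R n}.

Lemma cst_CinfE (c : R) (p : M) : cst_Cinf M c p = c.
Proof. by []. Qed.

Lemma tappE (t : tensor11 M) (X : vfield M) (p : M) : tapp t X p = t p (X p).
Proof. by []. Qed.

End Evaluation.

(** Reduces an equation between vector fields to an equation between real
    numbers, at a point [p] and against a smooth function [f]. *)
Ltac at_point_and_function p f :=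
  apply: vfield_ext => p; apply: tangent_ext => f;
  rewrite ?(tappE, vfieldDE, vfieldNE, vfieldZE, tangentDE, tangentNE,
            tangentZE, cst_CinfE).

Section TangentVectors.
Context {R : realType} {n : nat} {M : smoothManifold R n}.
Implicit Types (X Y Z : vfield M) (f g : Cinf M) (c : R).

Lemma tangentD (p : M) (v : tangent p) f g : v (f + g) = v f + v g.
Proof.
have := (tangentP v).1 1 f g; rewrite mul1r.
by have -> : cst_Cinf M 1 * f = f by apply: Cinf_ext => q; exact: mul1r.
Qed.

Lemma tangent0 (p : M) (v : tangent p) : v 0 = 0.
Proof. by apply: (@addrI _ (v 0)); rewrite -tangentD !addr0. Qed.

Lemma tangentZ (p : M) (v : tangent p) c f : v (cst_Cinf M c * f) = c * v f.
Proof. by have := (tangentP v).1 c f 0; rewrite tangent0 !addr0. Qed.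

Lemma bracketE X Y p f : bracket X Y p f = X p (vapp Y f) - Y p (vapp X f).
Proof. by []. Qed.

Lemma bracketC X Y : bracket X Y = - bracket Y X.
Proof.
apply: vfield_ext => p; apply: tangent_ext => f.
by rewrite vfieldNE tangentNE !bracketE opprB.
Qed.

Lemma bracketDl X Y Z : bracket (X + Y) Z = bracket X Z + bracket Y Z.
Proof.
apply: vfield_ext => p; apply: tangent_ext => f.
rewrite vfieldDE tangentDE !bracketE vfieldDE tangentDE.
have -> : vapp (X + Y) f = vapp X f + vapp Y f by apply: Cinf_ext.
by rewrite tangentD opprD addrACA.
Qed.

Lemma bracketDr X Y Z : bracket X (Y + Z) = bracket X Y + bracket X Z.
Proof. by rewrite bracketC bracketDl opprD -!bracketC. Qed.

(** Only constants come out of a bracket: a scalar function would contribute a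
    term in its derivative along [Y]. *)
Lemma bracketZl c X Y :
  bracket (cst_Cinf M c *: X) Y = cst_Cinf M c *: bracket X Y.
Proof.
apply: vfield_ext => p; apply: tangent_ext => f.
rewrite vfieldZE tangentZE !bracketE vfieldZE tangentZE.
have -> : vapp (cst_Cinf M c *: X) f = cst_Cinf M c * vapp X f.
  by apply: Cinf_ext.
by rewrite tangentZ mulrBr.
Qed.

Lemma bracketZr c X Y :
  bracket X (cst_Cinf M c *: Y) = cst_Cinf M c *: bracket X Y.
Proof. by rewrite bracketC bracketZl -scalerN -bracketC. Qed.

Lemma vapp_cst X c : vapp X (cst_Cinf M c) = 0.
Proof.
apply: Cinf_ext => p; rewrite [LHS]/=.
have v1 : X p 1 = 0.
  have := (tangentP (X p)).2 1 1; rewrite mulr1 !mul1r => /esym/eqP.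
  by rewrite -subr_eq0 addrK => /eqP.
have -> : cst_Cinf M c = cst_Cinf M c * 1 by rewrite mulr1.
by rewrite tangentZ v1 mulr0.
Qed.

Lemma covZ_cst (nabla : connection M) c X Y :
  nabla X (cst_Cinf M c *: Y) = cst_Cinf M c *: nabla X Y.
Proof. by rewrite cov_leibniz vapp_cst scale0r add0r. Qed.

End TangentVectors.

(** * The Nijenhuis tensor on eigenfields *)

Section Eigenfields.
Context {R : realType} {n : nat} {M : smoothManifold R n} (phi : tensor11 M).
Implicit Types (X Y : vfield M) (c d : R).

Lemma in_eigendistributionP c X :
  in_distribution (eigendistribution phi c) X <->
  tapp phi X = cst_Cinf M c *: X.
Proof.
split=> [DX|E p]; first by apply: vfield_ext => p; exact: subr0_eq (DX p).
apply/eqP; rewrite subr_eq0; apply/eqP.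
exact: (congr1 (fun Z : vfield M => Z p) E).
Qed.

(** The eigenvalues are constant, so they come out of every bracket; what is left
    factors as [(phi - c)(phi - d)] applied to [[X, Y]]. *)
Lemma nijenhuis_eigen c d X Y :
  in_distribution (eigendistribution phi c) X ->
  in_distribution (eigendistribution phi d) Y ->
  nijenhuis phi X Y =
    tapp phi (tapp phi (bracket X Y))
    - cst_Cinf M (c + d) *: tapp phi (bracket X Y)
    + cst_Cinf M (c * d) *: bracket X Y.
Proof.
move=> /in_eigendistributionP EX /in_eigendistributionP EY.
rewrite /nijenhuis EX EY !bracketZl !bracketZr !(linearZZ (tapp phi)).
by at_point_and_function p f; ring.
Qed.

Lemma nijenhuisDl X X' Y :
  nijenhuis phi (X + X') Y = nijenhuis phi X Y + nijenhuis phi X' Y.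
Proof.
rewrite /nijenhuis !(linearD (tapp phi)) !bracketDl !(linearD (tapp phi)).
by at_point_and_function p f; ring.
Qed.

Lemma nijenhuisC X Y : nijenhuis phi X Y = - nijenhuis phi Y X.
Proof.
rewrite /nijenhuis (bracketC X Y) (bracketC (tapp phi X) (tapp phi Y)).
rewrite (bracketC (tapp phi X) Y) (bracketC X (tapp phi Y)).
rewrite !(linearN (tapp phi)).
by at_point_and_function p f; ring.
Qed.

Lemma nijenhuisDr X Y Y' :
  nijenhuis phi X (Y + Y') = nijenhuis phi X Y + nijenhuis phi X Y'.
Proof. by rewrite nijenhuisC nijenhuisDl opprD -!nijenhuisC. Qed.

End Eigenfields.

(** * Golden structures and the canonical torsion *)

Section GoldenEigenfields.
Context {R : realType} {n : nat} {M : smoothManifold R n} (phi : tensor11 M).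
Context (phi_golden :
  forall p (v : tangent p), phi p (phi p v) = phi p v + v).
Implicit Types (X Y : vfield M) (c d : R).

Lemma tapp_golden X : tapp phi (tapp phi X) = tapp phi X + X.
Proof. by apply: vfield_ext => p; exact: phi_golden. Qed.

(** Here [(phi - c)(phi - d)] is the golden polynomial, which kills every field,
    so that mixed pairs never obstruct integrability. *)
Lemma nijenhuis_mixed c d X Y : c + d = 1 -> c * d = -1 ->
  in_distribution (eigendistribution phi c) X ->
  in_distribution (eigendistribution phi d) Y ->
  nijenhuis phi X Y = 0.
Proof.
move=> cDd cMd DX DY; rewrite (nijenhuis_eigen DX DY) cDd cMd tapp_golden.
at_point_and_function p f.
by rewrite tangent0E; ring.
Qed.

(** [(phi - d) / (c - d)] is the projector onto the eigendistribution of [c]. *)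
Lemma golden_projection c d X : c + d = 1 -> c * d = -1 ->
  in_distribution (eigendistribution phi c)
    (cst_Cinf M (c - d)^-1 *: (tapp phi X - cst_Cinf M d *: X)).
Proof.
move=> cDd cMd; apply/in_eigendistributionP.
rewrite (linearZZ (tapp phi)) (linearB (tapp phi)) (linearZZ (tapp phi)).
rewrite /= tapp_golden; at_point_and_function p f.
have cE : c = 1 - d by rewrite -cDd addrK.
rewrite mulrCA [c * (_ - _)]mulrBr (mulrA c d) cMd cE.
by congr (_ * _); ring.
Qed.

Lemma golden_decomposition c d X : c + d = 1 -> c * d = -1 -> c != d ->
  exists X1 X2, [/\ in_distribution (eigendistribution phi c) X1,
    in_distribution (eigendistribution phi d) X2 & X = X1 + X2].
Proof.
move=> cDd cMd cd; rewrite -subr_eq0 in cd.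
exists (cst_Cinf M (c - d)^-1 *: (tapp phi X - cst_Cinf M d *: X)).
exists (cst_Cinf M (d - c)^-1 *: (tapp phi X - cst_Cinf M c *: X)).
split; first exact: golden_projection.
  by apply: golden_projection; rewrite 1?addrC 1?mulrC.
at_point_and_function p f.
have dc : d - c != 0 by rewrite -opprB oppr_eq0.
by field; rewrite cd dc.
Qed.

Lemma almost_productK X :
  tapp (almost_product phi) (tapp (almost_product phi) X) = X.
Proof.
apply: vfield_ext => p; rewrite /= /almost_product_at.
rewrite !(linearZZ (phi p), linearB (phi p)) /= phi_golden.
apply: tangent_ext => f.
rewrite !(tangentDE, tangentNE, tangentZE).
have s5 := sqrt5M R.
have s0 := sqrt5_neq0 R.
by field: s5.
Qed.

(** The terms in [nabla X Y] combine because [J] is an involution.  In this form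
    the connection visibly projects onto the common eigendistribution: if
    [J Y = s Y] with [s = 1] or [s = -1], it is [(1 + s J) / 2] applied to
    [nabla X Y]. *)
Lemma first_canonical_covE (nabla : connection M) X Y :
  let J := almost_product phi in
  first_canonical_cov nabla phi X Y =
    cst_Cinf M 2^-1 *: (nabla X Y + tapp J (nabla X (tapp J Y))).
Proof.
rewrite /= /first_canonical_cov /cov_tensor almost_productK.
by have s0 := sqrt5_neq0 R; at_point_and_function p f; field.
Qed.

Lemma almost_product_eigen c X :
  in_distribution (eigendistribution phi c) X ->
  tapp (almost_product phi) X =
    cst_Cinf M ((Num.sqrt 5)^-1 * (2 * c - 1)) *: X.
Proof.
move=> DX; at_point_and_function p f.
by rewrite (subr0_eq (DX p)) tangentZE; ring.
Qed.

(** Both tensors measure the component of the bracket transverse to the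
    eigendistribution: with [s = (2 c - 1) / sqrt 5], the torsion is
    [(s J - 1) / 2] of the bracket, that is [(phi - c) / (2 c - 1)], while the
    Nijenhuis tensor is [(phi - c)^2 = (1 - 2 c) (phi - c)] of it.  Their
    quotient [- (2 c - 1)^2] is [- 5] for either root. *)
Lemma nijenhuis_torsion (nabla : connection M) c X Y : c ^+ 2 = c + 1 ->
  (forall X Y, torsion nabla X Y = 0) ->
  in_distribution (eigendistribution phi c) X ->
  in_distribution (eigendistribution phi c) Y ->
  nijenhuis phi X Y =
    cst_Cinf M (- 5) *: torsion (first_canonical_connection nabla phi) X Y.
Proof.
move=> cc tors0 DX DY; rewrite (nijenhuis_eigen DX DY) tapp_golden -expr2 cc.
(* Eliminating [nabla X Y] leaves an identity linear in the independent
   quantities [nabla Y X] and [bracket X Y]. *)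
have EB : nabla X Y = nabla Y X + bracket X Y.
  by apply/subr0_eq; rewrite opprD addrA; exact: tors0.
rewrite /torsion /= !first_canonical_covE (almost_product_eigen DX).
rewrite (almost_product_eigen DY) !covZ_cst !linearZZ EB.
rewrite (linearD (tapp (almost_product phi))) /=.
at_point_and_function p f.
have s5 := sqrt5M R.
have s0 := sqrt5_neq0 R.
by field: s5 cc.
Qed.

End GoldenEigenfields.

Theorem theorem5p2 (R : realType) (n : nat) (M : smoothManifold R n)
  (phi : tensor11 M) (g : riemannian_metric M)
  (nablag : connection M)
  (phi_g_golden : almost_golden_riemannian phi g)
  (nablag_levi_civita : levi_civita g nablag) :
  let nabla0 := first_canonical_connection nablag phi in
  let D_phi := eigendistribution phi golden_ratio in
  let D_phibar := eigendistribution phi golden_ratio_conj in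
  integrable_structure phi <->
  (forall X Y : vfield M, in_distribution D_phi X -> in_distribution D_phi Y ->
     torsion nabla0 X Y = 0) /\
  (forall X Y : vfield M,
     in_distribution D_phibar X -> in_distribution D_phibar Y ->
     torsion nabla0 X Y = 0).
Proof.
move=> nabla0 D_phi D_phibar.
have phi_golden := phi_g_golden.1.1; have tors0 := nablag_levi_civita.1.
have aDb := golden_ratioD R; have aMb := golden_ratioM R.
have torsion0 c X Y : c ^+ 2 = c + 1 -> integrable_structure phi ->
    in_distribution (eigendistribution phi c) X ->
    in_distribution (eigendistribution phi c) Y -> torsion nabla0 X Y = 0.
  move=> cc N0 DX DY.
  have := nijenhuis_torsion phi_golden cc tors0 DX DY.
  rewrite N0 => /(congr1 (fun Z => cst_Cinf M (- 5)^-1 *: Z)).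
  rewrite scaler0 scalerA.
  have -> : cst_Cinf M (- 5)^-1 * cst_Cinf M (- 5) = 1.
    by apply: Cinf_ext => p; rewrite [LHS]mulVf ?oppr_eq0 ?pnatr_eq0.
  by rewrite scale1r.
split=> [N0|[Ta Tb] X Y].
  split=> X Y; apply: torsion0 => //; first exact: sqr_golden_ratio.
  exact: sqr_golden_ratio_conj.
have [X1 [X2 [DX1 DX2 ->]]] :=
  golden_decomposition phi_golden X aDb aMb (golden_ratio_neq R).
have [Y1 [Y2 [DY1 DY2 ->]]] :=
  golden_decomposition phi_golden Y aDb aMb (golden_ratio_neq R).
rewrite nijenhuisDl !nijenhuisDr.
rewrite (nijenhuis_torsion phi_golden (sqr_golden_ratio R) tors0 DX1 DY1).
rewrite (nijenhuis_torsion phi_golden (sqr_golden_ratio_conj R) tors0 DX2 DY2).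
rewrite Ta // Tb // !scaler0 (nijenhuis_mixed phi_golden aDb aMb DX1 DY2).
rewrite (nijenhuisC _ X2) (nijenhuis_mixed phi_golden aDb aMb DY1 DX2).
by rewrite oppr0 !addr0.
Qed.
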